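(* Let $(t_m)_{1\le m\le N_0}\in[0,T]^{N_0}$ and $\delta_m>0$ be such that $[0,T]\subset\bigcup_{m=1}^{N_0}[t_m-\delta_m,t_m+\delta_m]$, and let $\delta_{\max}:=\max_{1\le m\le N_0}\delta_m$. Let $\delta\ge\delta_{\max}$ and $\vec\epsilon\in\mathbb R_+^P$. If, for a given $y_0\ge0$, $\vec\epsilon\ge\sup_{t\in[0,T]}[\vec\eta(\delta,t)\,y_0+\vec\omega(\delta,t)]$ (componentwise), then $$(\mathcal V_\epsilon\cap y_0\mathbb B_K)\subset\mathcal V_{\delta,\mathrm{inf}}\subset\mathcal V_{\delta,\mathrm{fin}}\subset\mathcal V_0.$$
   Context: Setting. $T>0$ is finite, $N,M,P\ge1$ are integers. For $t\in[0,T]$: $\mathbf A(t)\in\mathbb R^{N,N}$, $\mathbf B(t)\in\mathbb R^{N,M}$, $\mathbf C(t)\in\mathbb R^{P,N}$ with rows $\mathbf c_i(t)^\top$, $\mathbf d(t)=(d_i(t))_i\in\mathbb R^P$, and $\mathbf Q(t)\in\mathbb R^{N,N}$, $\mathbf R(t)\in\mathbb R^{M,M}$ are (symmetric) positive semidefinite. Standing assumptions: $\mathbf A(\cdot)\in L^1(0,T)$, $\mathbf B(\cdot)\in L^2(0,T)$, $\mathbf Q(\cdot)\in L^1(0,T)$, $\mathbf R(\cdot)\in L^2(0,T)$, and there is $r>0$ with $\mathbf R(t)\succcurlyeq r\,\mathrm{Id}_M$ for all $t\in[0,T]$. Inequalities between vectors of $\mathbb R^P$ are componentwise. Space of trajectories.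 $\mathcal S$ is the set of absolutely continuous $\mathbf x:[0,T]\to\mathbb R^N$ for which there is a measurable $\mathbf u:[0,T]\to\mathbb R^M$ with $\mathbf x'(t)=\mathbf A(t)\mathbf x(t)+\mathbf B(t)\mathbf u(t)$ a.e. and $\int_0^T\mathbf u(t)^\top\mathbf R(t)\mathbf u(t)\,dt<\infty$. To each $\mathbf x(\cdot)\in\mathcal S$ one associates the control $\mathbf u(t)=\mathbf B(t)^{\ominus}[\mathbf x'(t)-\mathbf A(t)\mathbf x(t)]$ a.e., where $\mathbf B(t)^\ominus$ is the pseudoinverse of $\mathbf B(t)$ for the norm $\|\mathbf R(t)^{1/2}\cdot\|$ on $\mathbb R^M$ (i.e. $\mathbf u(t)$ is the solution of $\mathbf B(t)\mathbf u=\mathbf x'(t)-\mathbf A(t)\mathbf x(t)$ of minimal $\|\mathbf R(t)^{1/2}\cdot\|$-norm). With $\mathbf u_1,\mathbf u_2$ the controls associated to $\mathbf x_1,\mathbf x_2\in\mathcal S$, $$\langle\mathbf x_1,\mathbf x_2\rangle_K:=\mathbf x_1(0)^\top\mathbf x_2(0)+\int_0^T[\mathbf x_1(t)^\top\mathbf Q(t)\mathbf x_2(t)+\mathbf u_1(t)^\top\mathbf R(t)\mathbf u_2(t)]\,dt,$$ with norm $\|\cdot\|_K$ and closed unit ball $\mathbb B_K\subset\mathcal S$. $(\mathcal S,\langle\cdot,\cdot\rangle_K)$ is a Hilbert space with continuous point evaluations, and $K:[0,T]\times[0,T]\to\mathbb R^{N,N}$ denotes its matrix-valued reproducing kernel: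 the unique map with $K(\cdot,t)\mathbf p\in\mathcal S$ and $\mathbf p^\top\mathbf x(t)=\langle\mathbf x(\cdot),K(\cdot,t)\mathbf p\rangle_K$ for all $t\in[0,T]$, $\mathbf p\in\mathbb R^N$, $\mathbf x(\cdot)\in\mathcal S$. Perturbations and constraint sets. For $\delta\ge0$, $t\in[0,T]$, $1\le i\le P$ (all these quantities being assumed to be real numbers, i.e. finite): $\eta_i(\delta,t):=\sup_{s\in[t-\delta,t+\delta]\cap[0,T]}\|K(\cdot,t)\mathbf c_i(t)-K(\cdot,s)\mathbf c_i(s)\|_K$, $\omega_i(\delta,t):=\sup_{s\in[t-\delta,t+\delta]\cap[0,T]}|d_i(t)-d_i(s)|$, $d_i(\delta,t):=\inf_{s\in[t-\delta,t+\delta]\cap[0,T]}d_i(s)$, and $\vec\eta=(\eta_i)_i$, $\vec\omega=(\omega_i)_i$, $\mathbf d(\delta,t)=(d_i(\delta,t))_i\in\mathbb R^P$. Then $\mathcal V_0:=\{\mathbf x\in\mathcal S:\mathbf C(t)\mathbf x(t)\le\mathbf d(t)\ \forall t\in[0,T]\}$, $\mathcal V_{\delta,\mathrm{fin}}:=\{\mathbf x\in\mathcal S:\vec\eta(\delta_m,t_m)\|\mathbf x(\cdot)\|_K+\mathbf C(t_m)\mathbf x(t_m)\le\mathbf d(\delta_m,t_m)\ \forall 1\le m\le N_0\}$, $\mathcal V_{\delta,\mathrm{inf}}:=\{\mathbf x\in\mathcal S:\vec\eta(\delta,t)\|\mathbf x(\cdot)\|_K+\vec\omega(\delta,t)+\mathbf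 C(t)\mathbf x(t)\le\mathbf d(t)\ \forall t\in[0,T]\}$, $\mathcal V_\epsilon:=\{\mathbf x\in\mathcal S:\vec\epsilon+\mathbf C(t)\mathbf x(t)\le\mathbf d(t)\ \forall t\in[0,T]\}$. *)

(* Defs.v *)
From HB Require Import structures.
From mathcomp Require Import all_boot all_order all_algebra.
From mathcomp Require Import all_classical all_reals all_analysis.

Set Implicit Arguments.
Unset Strict Implicit.
Unset Printing Implicit Defensive.

Import Order.TTheory GRing.Theory Num.Theory.
Import numFieldNormedType.Exports.

Local Open Scope classical_set_scope.
Local Open Scope ring_scope.

(* Functions of time are total functions on R.  Only their restriction to
   [0, T] matters: the values outside can at most influence the derivatives at
   0 and T, which are only ever used up to null sets.

   Measurability and integrals are those of the completed Lebesgue measure: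
   measurable means Lebesgue-measurable, not just Borel. *)

Notation leb R := (@completed_lebesgue_measure R).

(* R equipped with the sigma-algebra of Lebesgue-measurable sets *)
Notation lebT R := (caratheodory_type (R := R) (T := ocitv_type R)
  (mu_ext (@wlength R idfun))).

Section Vectors.
Context {R : realType}.

Definition bform m n (G : 'M[R]_(m, n)) (u : 'cV[R]_m) (v : 'cV[R]_n) : R :=
  (u^T *m G *m v) 0 0.

Definition psdmx n (G : 'M[R]_n) : Prop :=
  G^T = G /\ forall v : 'cV[R]_n, 0 <= bform G v v.

(* |W^{1/2} u|, where |W^{1/2} u|^2 = u^T W u *)
Definition wnorm n (W : 'M[R]_n) (u : 'cV[R]_n) : R := Num.sqrt (bform W u u).

Definition lecv n (u v : 'cV[R]_n) : Prop := forall i, u i 0 <= v i 0.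

Definition min_norm_solution m n (W : 'M[R]_m) (B : 'M[R]_(n, m))
    (y : 'cV[R]_n) (u : 'cV[R]_m) : Prop :=
  B *m u = y /\ forall v : 'cV[R]_m, B *m v = y -> wnorm W u <= wnorm W v.

(* The pseudoinverse of B for the norm |W^{1/2} .|, as a map on the range of B.
   For W positive definite the minimal-norm solution exists and is unique
   whenever y is in the range of B; outside the range the value is 0 (for
   trajectories this only happens on a null set of times). *)
Definition wpinv m n (W : 'M[R]_m) (B : 'M[R]_(n, m)) (y : 'cV[R]_n) : 'cV[R]_m :=
  xget 0 [set u | min_norm_solution W B y u].

End Vectors.

Section TimeFunctions.
Context {R : realType} (T : R).

Definition measurable_mx m n (F : R -> 'M[R]_(m, n)) : Prop :=
  forall i j, measurable_fun (`[0, T] : set (lebT R)) (fun t : lebT R => F t i j).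

Definition L1mx m n (F : R -> 'M[R]_(m, n)) : Prop :=
  forall i j, (leb R).-integrable `[0, T] (fun t : lebT R => (F t i j)%:E).

Definition L2mx m n (F : R -> 'M[R]_(m, n)) : Prop :=
  measurable_mx F /\
  forall i j, (leb R).-integrable `[0, T] (fun t : lebT R => (F t i j ^+ 2)%:E).

(* finite families of non-overlapping intervals [a k, b k] in [0, T] *)
Definition absolutely_continuous n (x : R -> 'cV[R]_n) : Prop :=
  forall e : R, 0 < e -> exists2 rho : R, 0 < rho &
    forall (q : nat) (a b : 'I_q -> R),
      (forall k, 0 <= a k /\ a k <= b k /\ b k <= T) ->
      (forall k l, k != l -> b k <= a l \/ b l <= a k) ->
      \sum_(k < q) (b k - a k) < rho ->
      \sum_(k < q) `|x (b k) - x (a k)| < e.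

End TimeFunctions.

(* The linear system x' = A x + B u with state weight Q and control weight W. *)
Section Trajectories.
Context {R : realType} {N M : nat} (T : R).
Variables (A : R -> 'M[R]_N) (B : R -> 'M[R]_(N, M)).
Variables (Q : R -> 'M[R]_N) (W : R -> 'M[R]_M).

Definition trajectories : set (R -> 'cV[R]_N) :=
  [set x | absolutely_continuous T x /\
    exists u : R -> 'cV[R]_M,
      [/\ measurable_mx T u,
          {ae leb R, forall t : lebT R, t \in `[0, T] ->
            derivable x t 1 /\ derive1 x t = A t *m x t + B t *m u t}
        & (\int[leb R]_(t in `[0%R, T]) (bform (W t) (u t) (u t))%:E < +oo)%E]].

Definition control (x : R -> 'cV[R]_N) (t : R) : 'cV[R]_M :=
  wpinv (W t) (B t) (derive1 x t - A t *m x t).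

Definition ipK (x1 x2 : R -> 'cV[R]_N) : R :=
  ((x1 0)^T *m x2 0) 0 0 +
  \int[leb R]_(t in `[0, T])
    (bform (Q t) (x1 t) (x2 t) + bform (W t) (control x1 t) (control x2 t)).

Definition normK (x : R -> 'cV[R]_N) : R := Num.sqrt (ipK x x).

Definition ballK : set (R -> 'cV[R]_N) := trajectories `&` [set x | normK x <= 1].

(* y0 * ballK, up to the values outside [0, T] *)
Definition dilated_ballK (y0 : R) : set (R -> 'cV[R]_N) :=
  trajectories `&`
  [set x | exists2 z, ballK z & forall t, t \in `[0, T] -> x t = y0 *: z t].

Definition reproducing_kernel (K : R -> R -> 'M[R]_N) : Prop :=
  forall t, t \in `[0, T] -> forall p : 'cV[R]_N,
    trajectories (fun s => K s t *m p) /\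
    forall x, trajectories x ->
      (p^T *m x t) 0 0 = ipK x (fun s => K s t *m p).

End Trajectories.

Section Constraints.
Context {R : realType} {N M P : nat} (T : R).
Variables (A : R -> 'M[R]_N) (B : R -> 'M[R]_(N, M)).
Variables (Q : R -> 'M[R]_N) (W : R -> 'M[R]_M).
Variables (C : R -> 'M[R]_(P, N)) (d : R -> 'cV[R]_P) (K : R -> R -> 'M[R]_N).

Definition window (delta t : R) : set R := `[t - delta, t + delta] `&` `[0, T].

(* c_i(t), where c_i(t)^T is the i-th row of C(t) *)
Definition crow (t : R) (i : 'I_P) : 'cV[R]_N := (row i (C t))^T.

Definition eta_set (delta t : R) (i : 'I_P) : set R :=
  [set normK T A B Q W (fun z => K z t *m crow t i - K z s *m crow s i)
    | s in window delta t].

Definition omega_set (delta t : R) (i : 'I_P) : set R :=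
  [set `|d t i 0 - d s i 0| | s in window delta t].

Definition dinf_set (delta t : R) (i : 'I_P) : set R :=
  [set d s i 0 | s in window delta t].

(* These are genuine suprema and infima only under finite_perturbations. *)
Definition etavec (delta t : R) : 'cV[R]_P := \col_i sup (eta_set delta t i).
Definition omegavec (delta t : R) : 'cV[R]_P := \col_i sup (omega_set delta t i).
Definition dinf (delta t : R) : 'cV[R]_P := \col_i inf (dinf_set delta t i).

Definition finite_perturbations : Prop :=
  forall delta t i, 0 <= delta -> t \in `[0, T] ->
    [/\ has_ubound (eta_set delta t i), has_ubound (omega_set delta t i)
      & has_lbound (dinf_set delta t i)].

Let S := trajectories T A B W.
Let nK := normK T A B Q W.

Definition V_0 : set (R -> 'cV[R]_N) :=
  S `&` [set x | forall t, t \in `[0, T] -> lecv (C t *m x t) (d t)].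

Definition V_fin N0 (tm dm : 'I_N0 -> R) : set (R -> 'cV[R]_N) :=
  S `&` [set x | forall m,
    lecv (nK x *: etavec (dm m) (tm m) + C (tm m) *m x (tm m))
         (dinf (dm m) (tm m))].

Definition V_inf (delta : R) : set (R -> 'cV[R]_N) :=
  S `&` [set x | forall t, t \in `[0, T] ->
    lecv (nK x *: etavec delta t + omegavec delta t + C t *m x t) (d t)].

Definition V_eps (eps : 'cV[R]_P) : set (R -> 'cV[R]_N) :=
  S `&` [set x | forall t, t \in `[0, T] -> lecv (eps + C t *m x t) (d t)].

End Constraints.

(* Main.v *)
Require Import Defs.
From HB Require Import structures.
From mathcomp Require Import all_boot all_order all_algebra.
From mathcomp Require Import all_classical all_reals all_analysis.
From mathcomp Require Import measurable_realfun ring lra.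

Set Implicit Arguments.
Unset Strict Implicit.
Unset Printing Implicit Defensive.

Import Order.TTheory GRing.Theory Num.Theory.
Import numFieldNormedType.Exports.

Local Open Scope classical_set_scope.
Local Open Scope ring_scope.

(** Each scalar constraint c_i(t)^T x(t) <= d_i(t) is an evaluation of x, so by
    the reproducing property it moves by at most |x|_K times the distance
    between the representers K(., t) c_i(t) and K(., s) c_i(s) when t is replaced
    by s (lemma reproducing_variation).  The number eta_i(delta, t) bounds that
    distance over a window.  Tightening the constraint at the center t_m of a
    window by eta_i |x|_K, with d_i replaced by its infimum over the window,
    therefore enforces it on the whole window, and the windows cover [0, T]: this
    is the last inclusion.  The middle inclusion compares suprema over nested
    windows and uses inf d_i >= d_i(t_m) - omega_i.  For the first one, a
    trajectory of y0 B_K has norm at most y0 (lemma norm_dilation), so that eps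
    dominates eta_i |x|_K + omega_i.

    What has to be established is that the K-product behaves as an inner product:
    trajectories form a vector space, the product is bilinear and satisfies the
    Cauchy-Schwarz inequality.  All of this is additivity of integrals, so it
    needs the integrand to be integrable, hence the control associated to a
    trajectory to be measurable.  That control is a pointwise minimal-norm
    solution of B(t) u = x'(t) - A(t) x(t).  Two descriptions of such solutions
    are used.  The Lagrange conditions (wpinv_lagrange) show that the control is
    linear in the trajectory and has the least energy among all admissible
    inputs, so that its energy is finite.  The limit of penalized least squares
    problems (penalized_cvg) exhibits it as a pointwise limit of rational
    functions of measurable matrix entries, so that it is measurable. *)

(** * Quadratic forms *)

Section QuadraticForms.
Context {R : realType}.

Lemma bformE m n (G : 'M[R]_(m, n)) u v :
  bform G u v = \sum_i \sum_j u i 0 * G i j * v j 0.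
Proof.
rewrite /bform mxE exchange_big /=; apply: eq_bigr => j _.
by rewrite mxE mulr_suml; apply: eq_bigr => i _; rewrite mxE.
Qed.

Lemma bform_mulmx m n (G : 'M[R]_(m, n)) u v :
  bform G u v = (u^T *m (G *m v)) 0 0.
Proof. by rewrite /bform mulmxA. Qed.

Lemma bformDl m n (G : 'M[R]_(m, n)) u1 u2 v :
  bform G (u1 + u2) v = bform G u1 v + bform G u2 v.
Proof. by rewrite /bform linearD /= !mulmxDl mxE. Qed.

Lemma bformDr m n (G : 'M[R]_(m, n)) u v1 v2 :
  bform G u (v1 + v2) = bform G u v1 + bform G u v2.
Proof. by rewrite /bform mulmxDr mxE. Qed.

Lemma bformZl m n (G : 'M[R]_(m, n)) a u v :
  bform G (a *: u) v = a * bform G u v.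
Proof. by rewrite /bform linearZ /= -!scalemxAl mxE. Qed.

Lemma bformZr m n (G : 'M[R]_(m, n)) a u v :
  bform G u (a *: v) = a * bform G u v.
Proof. by rewrite /bform -scalemxAr mxE. Qed.

Lemma bform_sym n (G : 'M[R]_n) u v : G^T = G -> bform G u v = bform G v u.
Proof.
move=> sG; rewrite /bform -[in LHS](trmxK (u^T *m G *m v)) mxE.
by rewrite !trmx_mul sG trmxK mulmxA.
Qed.

Lemma psd_bform_sqD n (G : 'M[R]_n) u v : psdmx G ->
  bform G (u + v) (u + v) = bform G u u + 2 * bform G u v + bform G v v.
Proof.
by move=> [sG _]; rewrite bformDl !bformDr (bform_sym v u sG); ring.
Qed.

(** Expanding the nonnegative values of the form at u + v and u - v. *)
Lemma psd_bform_le n (G : 'M[R]_n) u v : psdmx G ->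
  `|bform G u v| <= bform G u u + bform G v v.
Proof.
move=> hG; have := psd_bform_sqD u v hG; have := psd_bform_sqD u (-1 *: v) hG.
rewrite bformZr !bformZl bformZr => Em Ep.
have hm := hG.2 (u + -1 *: v); have hp := hG.2 (u + v).
have hu := hG.2 u; have hv := hG.2 v.
by rewrite ler_norml; apply/andP; split; lra.
Qed.

Lemma coercive_entry_le n (W : 'M[R]_n) r (u : 'cV[R]_n) i :
  0 <= r -> psdmx (W - r%:M) -> r * u i 0 ^+ 2 <= bform W u u.
Proof.
move=> r0 [_ /(_ u)].
rewrite {1}/bform mulmxBr mulmxBl mxE [X in _ + X]mxE subr_ge0; apply: le_trans.
rewrite mul_mx_scalar -scalemxAl mxE ler_wpM2l// mxE (bigD1 i)//= mxE -expr2.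
by rewrite lerDl sumr_ge0// => j _; rewrite mxE -expr2 sqr_ge0.
Qed.

Lemma coercive_eq0 n (W : 'M[R]_n) r (u : 'cV[R]_n) :
  0 < r -> psdmx (W - r%:M) -> bform W u u <= 0 -> u = 0.
Proof.
move=> r0 hW u0; apply/matrixP => i j; rewrite ord1 mxE.
have := le_trans (coercive_entry_le u i (ltW r0) hW) u0.
by rewrite pmulr_rle0// => u2; apply/eqP; rewrite -sqrf_eq0 eq_le u2 sqr_ge0.
Qed.

Lemma unitmx_of_injective n (G : 'M[R]_n) :
  (forall u : 'cV[R]_n, G *m u = 0 -> u = 0) -> G \in unitmx.
Proof.
move=> G_inj; rewrite -unitmx_tr -row_free_unit; apply: inj_row_free => v vG.
apply: trmx_inj; rewrite trmx0; apply: G_inj.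
by rewrite -[LHS]trmxK trmx_mul trmxK vG trmx0.
Qed.

Lemma coercive_unitmx n (W : 'M[R]_n) r :
  0 < r -> psdmx (W - r%:M) -> W \in unitmx.
Proof.
move=> r0 hW; apply: unitmx_of_injective => u Wu0; apply: (coercive_eq0 r0 hW).
by rewrite bform_mulmx Wu0 mulmx0 mxE.
Qed.

Lemma psd_id p : psdmx (1%:M : 'M[R]_p).
Proof.
split=> [|v]; first exact: trmx1.
by rewrite /bform mulmx1 mxE sumr_ge0// => i _; rewrite mxE -expr2 sqr_ge0.
Qed.

End QuadraticForms.

(** * Minimal-norm solutions of underdetermined linear systems *)
Section WeightedPseudoinverse.
Context {R : realType} {m n : nat}.
Variables (W : 'M[R]_m) (B : 'M[R]_(n, m)) (r : R).
Hypotheses (r0 : 0 < r) (psdW : psdmx W) (coerW : psdmx (W - r%:M)).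

(** The Lagrange conditions for minimizing the W-norm subject to B u = y.
    Unlike minimality, they are visibly linear in (y, u). *)
Definition lagrange_solution (y : 'cV[R]_n) (u : 'cV[R]_m) : Prop :=
  B *m u = y /\ exists l, W *m u = B^T *m l.

Lemma lagrange_lin a y1 u1 y2 u2 :
  lagrange_solution y1 u1 -> lagrange_solution y2 u2 ->
  lagrange_solution (a *: y1 + y2) (a *: u1 + u2).
Proof.
move=> [<- [l1 E1]] [<- [l2 E2]]; split; first by rewrite mulmxDr -scalemxAr.
by exists (a *: l1 + l2); rewrite !mulmxDr -!scalemxAr E1 E2.
Qed.

(** Any other solution is u + k with k in the kernel of B, and k is
    W-orthogonal to u because W u is in the range of B^T. *)
Lemma lagrange_pythagoras y u v : lagrange_solution y u -> B *m v = y ->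
  bform W v v = bform W u u + bform W (v - u) (v - u).
Proof.
move=> [Bu [l Wu]] Bv; rewrite -{1 2}(subrK u v) psd_bform_sqD//.
have -> : bform W (v - u) u = 0.
  rewrite bform_mulmx Wu mulmxA -trmx_mul mulmxBr Bv Bu subrr trmx0 mul0mx.
  by rewrite mxE.
by ring.
Qed.

(** By the Pythagorean identity and coercivity, u is the only minimizer, so the
    choice made by the pseudoinverse is forced. *)
Lemma wpinv_lagrange y u : lagrange_solution y u -> wpinv W B y = u.
Proof.
move=> Lu; have [Bu _] := Lu.
have minu : min_norm_solution W B y u.
  split=> // v Bv; apply: ler_wsqrtr.
  by rewrite (lagrange_pythagoras Lu Bv) lerDl psdW.2.
have uniq v : min_norm_solution W B y v -> v = u.
  move=> [Bv /(_ u Bu)]; rewrite /wnorm ler_sqrt ?psdW.2//.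
  rewrite (lagrange_pythagoras Lu Bv) gerDl => /(coercive_eq0 r0 coerW).
  exact: subr0_eq.
rewrite /wpinv; case: xgetP => [v _ /uniq//|].
by move=> /(_ u)/(_ minu).
Qed.

(** The multiplier solves B W^-1 B^T l = B v.  If (B W^-1 B^T) w = 0 then
    B^T w = 0 by positivity, so that B v is in the range of that matrix. *)
Lemma lagrange_exists v : exists u, lagrange_solution (B *m v) u.
Proof.
have Wu := coercive_unitmx r0 coerW.
pose G := B *m invmx W *m B^T.
have sG : G^T = G by rewrite !trmx_mul trmxK trmx_inv psdW.1 mulmxA.
have kerG (w : 'cV[R]_n) : G *m w = 0 -> B^T *m w = 0.
  move=> Gw; pose z := invmx W *m (B^T *m w).
  have Wz : W *m z = B^T *m w by rewrite mulKVmx.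
  suff z0 : z = 0 by rewrite -Wz z0 mulmx0.
  apply: (coercive_eq0 r0 coerW).
  rewrite bform_mulmx Wz mulmxA -trmx_mul /z !mulmxA -/G Gw trmx0 mul0mx.
  by rewrite mxE.
have /submxP[l lE] : ((B *m v)^T <= G)%MS.
  rewrite submxE trmx_mul -mulmxA.
  suff -> : B^T *m cokermx G = 0 by rewrite mulmx0.
  apply/matrixP => i j.
  have /matrixP/(_ i 0) : B^T *m col j (cokermx G) = 0.
    by apply: kerG; rewrite colE mulmxA mulmx_coker mul0mx.
  by rewrite colE mulmxA -colE !mxE.
exists (invmx W *m (B^T *m l^T)); split; last by exists l^T; rewrite mulKVmx.
by rewrite !mulmxA -/G -[LHS]trmxK trmx_mul sG trmxK -lE trmxK.
Qed.

(** The minimizer u of |u|_W^2 + k |B u - B v|^2, given by the normal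
    equations. *)
Definition penalized v (k : nat) : 'cV[R]_m :=
  invmx (W + k%:R *: (B^T *m B)) *m (k%:R *: (B^T *m B *m v)).

Lemma gram_bform k (u : 'cV[R]_m) :
  bform (W + k%:R *: (B^T *m B)) u u
  = bform W u u + k%:R * bform 1%:M (B *m u) (B *m u).
Proof.
rewrite /bform mulmxDr mulmxDl mxE -scalemxAr -scalemxAl mulmx1 trmx_mul.
by rewrite [X in _ + X]mxE !mulmxA.
Qed.

Lemma gram_unitmx k : W + k%:R *: (B^T *m B) \in unitmx.
Proof.
apply: unitmx_of_injective => u Yu; apply: (coercive_eq0 r0 coerW).
suff : bform W u u + k%:R * bform 1%:M (B *m u) (B *m u) = 0.
  move=> /eqP; rewrite addr_eq0 => /eqP->.
  by rewrite oppr_le0 mulr_ge0// (psd_id _).2.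
by rewrite -gram_bform bform_mulmx Yu mulmx0 mxE.
Qed.

(** The error e satisfies (W + k B^T B) e = - W u = - B^T l; testing with e,
    |e|_W^2 + k |B e|^2 = - <B e, l> <= k |B e|^2 + |l|^2 / (4 k), where the
    inequality completes the square of k B e + l / 2. *)
Lemma penalized_error v u l k : B *m u = B *m v -> W *m u = B^T *m l ->
  (0 < k)%N ->
  bform W (penalized v k - u) (penalized v k - u) <= bform 1%:M l l / k%:R.
Proof.
move=> Bu Wu k0; set e := penalized v k - u.
have kR0 : 0 < k%:R :> R by rewrite ltr0n.
pose Y := W + k%:R *: (B^T *m B).
have Ye : Y *m e = - (B^T *m l).
  rewrite mulmxBr /penalized mulKVmx ?gram_unitmx// /Y mulmxDl -scalemxAl.
  by rewrite -!mulmxA Bu -Wu opprD addrCA subrr addr0.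
have bYe : bform Y e e = - bform 1%:M (B *m e) l.
  by rewrite bform_mulmx Ye /bform mulmx1 trmx_mul mulmxN mxE mulmxA.
have We : bform W e e = - bform 1%:M (B *m e) l
    - k%:R * bform 1%:M (B *m e) (B *m e).
  by rewrite -bYe gram_bform addrK.
rewrite ler_pdivlMr// mulrC We.
have := (psd_id n).2 l; have := (psd_id n).2 (k%:R *: (B *m e) + 2^-1 *: l).
rewrite (psd_bform_sqD _ _ (psd_id n)) !bformZl !bformZr.
move: (bform _ (B *m e) (B *m e)) (bform _ (B *m e) l) (bform _ l l).
by move=> BeBe Bel ll sq ll_ge0; lra.
Qed.

Lemma penalized_cvg v i :
  penalized v k i 0 @[k --> \oo] --> wpinv W B (B *m v) i 0.
Proof.
have [u Lu] := lagrange_exists v; rewrite (wpinv_lagrange Lu).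
have [Bu [l Wu]] := Lu.
apply/cvgrPdist_le => e e0.
near=> k.
have k0 : (0 < k)%N by near: k; exists 1%N.
have kR0 : 0 < k%:R :> R by rewrite ltr0n.
rewrite distrC -(ler_pXn2r (n := 2))// ?nnegrE ?normr_ge0 ?(ltW e0)//.
rewrite real_normK ?num_real//.
have := coercive_entry_le (penalized v k - u) i (ltW r0) coerW.
rewrite !mxE => h.
have := le_trans h (penalized_error Bu Wu k0).
rewrite -ler_pdivlMl// => /le_trans; apply.
have re2 : 0 < r * e ^+ 2 by rewrite mulr_gt0// exprn_gt0.
have : bform 1%:M l l / (r * e ^+ 2) <= k%:R.
  by near: k; exact: nbhs_infty_ger.
by rewrite ler_pdivrMr// => hk; rewrite ler_pdivrMl// ler_pdivrMr//; lra.
Unshelve. all: end_near. Qed.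

End WeightedPseudoinverse.

(** * Measurability of matrix-valued functions of time *)
Section Measurability.
Context {R : realType} (T : R).

Lemma measurable_0T : measurable (`[0, T]%classic : set (lebT R)).
Proof. by apply: sub_caratheodory; exact: (@measurable_itv R `[0, T]). Qed.

Lemma borel_measurable_leb (D : set R) (f : R -> R) : measurable D ->
  measurable_fun D f -> measurable_fun (D : set (lebT R)) (f : lebT R -> R).
Proof.
by move=> mD mf _ Y mY; apply: sub_caratheodory; exact: mf.
Qed.

Lemma measurable_mxD m n (F G : R -> 'M[R]_(m, n)) :
  measurable_mx T F -> measurable_mx T G -> measurable_mx T (fun t => F t + G t).
Proof.
move=> mF mG i j /=; under [X in measurable_fun _ X]eq_fun do rewrite mxE.
exact: measurable_funD.
Qed.

Lemma measurable_mxM m n p (F : R -> 'M[R]_(m, n)) (G : R -> 'M[R]_(n, p)) :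
  measurable_mx T F -> measurable_mx T G ->
  measurable_mx T (fun t => F t *m G t).
Proof.
move=> mF mG i j /=; under [X in measurable_fun _ X]eq_fun do rewrite mxE.
by apply: measurable_sum => k; exact: measurable_funM.
Qed.

Lemma measurable_mxZ m n a (F : R -> 'M[R]_(m, n)) :
  measurable_mx T F -> measurable_mx T (fun t => a *: F t).
Proof.
move=> mF i j /=; under [X in measurable_fun _ X]eq_fun do rewrite mxE.
by apply: measurable_funM => //; exact: measurable_cst.
Qed.

Lemma measurable_trmx m n (F : R -> 'M[R]_(m, n)) :
  measurable_mx T F -> measurable_mx T (fun t => (F t)^T).
Proof.
move=> mF i j /=; under [X in measurable_fun _ X]eq_fun do rewrite mxE.
exact: mF.
Qed.

Lemma measurable_bform m n (G : R -> 'M[R]_(m, n)) u v :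
  measurable_mx T G -> measurable_mx T u -> measurable_mx T v ->
  measurable_fun (`[0, T]%classic : set (lebT R))
    (fun t : lebT R => bform (G t) (u t) (v t)).
Proof.
move=> mG mu mv.
exact: (measurable_mxM (measurable_mxM (measurable_trmx mu) mG) mv).
Qed.

Lemma measurable_det n (F : R -> 'M[R]_n) : measurable_mx T F ->
  measurable_fun (`[0, T]%classic : set (lebT R)) (fun t : lebT R => \det (F t)).
Proof.
move=> mF; apply: measurable_sum => s; apply: measurable_funM.
  exact: measurable_cst.
by apply: measurable_prod => i _; exact: mF.
Qed.

Lemma measurable_inv d (X : measurableType d) (D : set X) (f : X -> R) :
  measurable_fun D f -> measurable_fun D (fun x => (f x)^-1).
Proof.
move=> mf.
(* the real powers are those of nonnegative numbers, hence the square *)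
have -> : (fun x => (f x)^-1) = (fun x => f x * (f x ^+ 2) `^ (-1)).
  apply/funext => x; rewrite powR_inv1 ?sqr_ge0//.
  have [->|f0] := eqVneq (f x) 0; first by rewrite invr0 mul0r.
  by rewrite expr2 invfM mulrA divff// mul1r.
apply: measurable_funM => //.
by apply: (measurableT_comp (measurable_powR (-1))); exact: measurable_funX.
Qed.

Lemma measurable_invmx n (F : R -> 'M[R]_n) :
  (forall t, t \in `[0, T] -> F t \in unitmx) ->
  measurable_mx T F -> measurable_mx T (fun t => invmx (F t)).
Proof.
move=> uF mF i j.
apply: (@eq_measurable_fun _ _ _ _ _
    (fun t : lebT R => (\det (F t))^-1 * ((-1) ^+ (j + i) *
       \det (row' j (col' i (F t)))))).
  by move=> t; rewrite inE => /= tT; rewrite /invmx uF// !mxE.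
apply: measurable_funM; first exact/measurable_inv/measurable_det.
apply: measurable_funM; first exact: measurable_cst.
apply: measurable_det => k l.
under [X in measurable_fun _ X]eq_fun do rewrite !mxE.
exact: mF.
Qed.

(** Unlike the minimal-norm solution, the penalized solutions are rational
    functions of the entries of W, B and v. *)
Lemma measurable_wpinv m n (W : R -> 'M[R]_m) (B : R -> 'M[R]_(n, m)) r
    (v : R -> 'cV[R]_m) : 0 < r ->
  (forall t, t \in `[0, T] -> psdmx (W t)) ->
  (forall t, t \in `[0, T] -> psdmx (W t - r%:M)) ->
  measurable_mx T W -> measurable_mx T B -> measurable_mx T v ->
  measurable_mx T (fun t => wpinv (W t) (B t) (B t *m v t)).
Proof.
move=> r0 psdW coerW mW mB mv i j; rewrite ord1.
apply: (@measurable_fun_cvg _ _ _ _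
  (fun k (t : lebT R) => penalized (W t) (B t) (v t) k i 0)); last first.
  by move=> t /= tT; apply: (penalized_cvg r0 (psdW t tT) (coerW t tT)).
move=> k.
have mBB := measurable_mxM (measurable_trmx mB) mB.
apply: (measurable_mxM (measurable_invmx _ _)).
- by move=> t tT; exact: (gram_unitmx _ r0 (coerW t tT)).
- exact/measurable_mxD/measurable_mxZ.
- exact/measurable_mxZ/measurable_mxM.
Qed.

(** This is where completeness of the measure matters. *)
Lemma measurable_mx_ae m n (F G : R -> 'M[R]_(m, n)) :
  {ae leb R, forall t : lebT R, t \in `[0, T] -> F t = G t} ->
  measurable_mx T F -> measurable_mx T G.
Proof.
move=> FG mF i j; apply/measurable_EFinP.
apply: (ae_measurable_fun completed_lebesgue_measure_is_complete
  (f := fun t : lebT R => (F t i j)%:E)); last exact/measurable_EFinP/mF.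
by apply: filterS FG => t FG /= tT; rewrite FG.
Qed.

End Measurability.

(** * Absolutely continuous functions *)
Section AbsoluteContinuity.
Context {R : realType} (T : R) {n : nat}.

Lemma entry_le_norm (u : 'cV[R]_n) i : `|u i 0| <= `|u|.
Proof.
rewrite [leRHS]/Num.Def.normr /= mx_normrE.
exact: (le_bigmax _ _ (i, 0)).
Qed.

Lemma ac_continuous (x : R -> 'cV[R]_n) i : absolutely_continuous T x ->
  {within `[0, T], continuous (fun t => x t i 0)}.
Proof.
move=> acx; apply/subspace_continuousP => t /= tT.
apply/cvgrPdist_lt => e e0; have [rho rho0 Hrho] := acx e e0.
rewrite near_withinE; near=> s => /= sT.
have st : `|t - s| < rho by near: s; exact: nbhsx_ballx.
have dist_le a b : a \in `[0, T] -> b \in `[0, T] -> a <= b -> b - a < rho ->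
    `|x b i 0 - x a i 0| < e.
  rewrite !in_itv /= => /andP[a0 aT] /andP[b0 bT] ab bar.
  have := Hrho 1%N (fun=> a) (fun=> b).
  rewrite !big_ord1 => H.
  have := entry_le_norm (x b - x a) i; rewrite !mxE => /le_lt_trans; apply.
  by apply: H => // k l; rewrite !ord1.
have [le_st|lt_ts] := leP s t.
  by apply: dist_le => //; rewrite -(ger0_norm (x := t - s)) ?subr_ge0.
rewrite distrC; apply: dist_le (ltW _) _ => //.
by rewrite distrC gtr0_norm ?subr_gt0// in st.
Unshelve. all: end_near. Qed.

Lemma ac_measurable (x : R -> 'cV[R]_n) :
  absolutely_continuous T x -> measurable_mx T x.
Proof.
move=> acx i j; rewrite ord1.
apply: (borel_measurable_leb (measurable_itv _)).
exact: (subspace_continuous_measurable_fun (measurable_itv _)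
  (ac_continuous acx)).
Qed.

Lemma ac_bounded (x : R -> 'cV[R]_n) i : absolutely_continuous T x ->
  [bounded x t i 0 | t in `[0, T]%classic].
Proof.
move=> acx.
have /compact_bounded[M [_ mrt]] :=
  continuous_compact (ac_continuous (i := i) acx) (@segment_compact R 0 T).
by exists M; split; rewrite ?num_real // => a Ma t tT; apply: mrt => //; exists t.
Qed.

Lemma ac_lin a (x y : R -> 'cV[R]_n) : absolutely_continuous T x ->
  absolutely_continuous T y -> absolutely_continuous T (fun t => a *: x t + y t).
Proof.
move=> acx acy e e0.
have a1 : 0 < `|a| + 1 by rewrite ltr_wpDl.
have e2 : 0 < e / 2 by rewrite divr_gt0.
have [rx rx0 Hx] := acx (e / 2 / (`|a| + 1)) (divr_gt0 e2 a1).
have [ry ry0 Hy] := acy (e / 2) e2.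
exists (Num.min rx ry); first by rewrite lt_min rx0.
move=> q s t st ov; rewrite lt_min => /andP[sx sy].
have {}Hx := Hx q s t st ov sx; have {}Hy := Hy q s t st ov sy.
apply: (@le_lt_trans _ _ (`|a| * (\sum_(k < q) `|x (t k) - x (s k)|) +
                          \sum_(k < q) `|y (t k) - y (s k)|)).
  rewrite mulr_sumr -big_split /= ler_sum// => k _.
  rewrite opprD addrACA -scalerBr (le_trans (ler_normD _ _))// lerD2r.
  by rewrite normrZ.
rewrite ltr_pdivlMr// in Hx.
have h0 : 0 <= \sum_(k < q) `|x (t k) - x (s k)| by rewrite sumr_ge0.
by lra.
Qed.

End AbsoluteContinuity.

(** * The space of trajectories and its inner product *)
Section TrajectorySpace.
Context {R : realType} {N M : nat} (T : R).
Variables (A : R -> 'M[R]_N) (B : R -> 'M[R]_(N, M)).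
Variables (Q : R -> 'M[R]_N) (W : R -> 'M[R]_M) (r : R).
Hypothesis T0 : 0 < T.
Hypotheses (L2B : L2mx T B) (L1Q : L1mx T Q) (L2W : L2mx T W).
Hypothesis psdQ : forall t, t \in `[0, T] -> psdmx (Q t).
Hypothesis psdW : forall t, t \in `[0, T] -> psdmx (W t).
Hypotheses (r0 : 0 < r) (coerW : forall t, t \in `[0, T] -> psdmx (W t - r%:M)).

Local Notation S := (trajectories T A B W).
Local Notation ctrl := (control A B W).
Local Notation ip := (ipK T A B Q W).
Local Notation norm := (normK T A B Q W).
Local Notation D := (`[0, T]%classic : set (lebT R)).
Local Notation energy u := (fun t : lebT R => (bform (W t) (u t) (u t))%:E).

Let mD : measurable D := measurable_0T T.

(** A trajectory satisfies x' - A x = B v for some input v, which puts x' - A x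
    in the range of B, where the pseudoinverse is characterized by the Lagrange
    conditions. *)
Lemma control_lagrange x : S x ->
  {ae leb R, forall t : lebT R, t \in `[0, T] -> derivable x t 1 /\
    lagrange_solution (W t) (B t) (derive1 x t - A t *m x t) (ctrl x t)}.
Proof.
move=> [_ [v [_ xv _]]]; apply: filterS xv => t /= xv tT.
have [dx ->] := xv tT; split=> //; rewrite /control.
have [dx' ->] := xv tT; rewrite addrAC subrr add0r.
have [u Lu] := lagrange_exists (B t) r0 (psdW tT) (coerW tT) (v t).
by rewrite (wpinv_lagrange r0 (psdW tT) (coerW tT) Lu).
Qed.

Lemma control_measurable x : S x -> measurable_mx T (ctrl x).
Proof.
move=> [_ [v [mv xv _]]].
apply: (measurable_mx_ae _ (measurable_wpinv r0 psdW coerW L2W.1 L2B.1 mv)).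
apply: filterS xv => t xv tT; have [_ E] := xv tT.
by rewrite /control E addrAC subrr add0r.
Qed.

(** At almost every time the associated control has the least energy among the
    inputs that generate x, one of which has finite total energy. *)
Lemma control_energy x : S x -> (leb R).-integrable D (energy (ctrl x)).
Proof.
move=> Sx; have mu := control_measurable Sx.
have := control_lagrange Sx; have [_ [v [mv xv fin]]] := Sx => Lx.
have mE u : measurable_mx T u -> measurable_fun D (energy u).
  by move=> hu; apply/measurable_EFinP; exact: (measurable_bform L2W.1 hu hu).
have E0 u t : D t -> (0 <= energy u t)%E.
  by move=> /= tT; rewrite lee_fin (psdW tT).2.
apply/integrableP; split; first exact: mE.
apply: le_lt_trans fin; under eq_integral.
  by move=> t; rewrite inE => tT; rewrite gee0_abs ?E0//; over.
apply: ae_ge0_le_integral; [exact: mD|exact: E0|exact: mE|exact: E0|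
  exact: mE|].
apply: filterS2 Lx xv => t Lx xv tT.
have [_ Lt] := Lx tT; have [_ E] := xv tT.
have Bv : B t *m v t = derive1 x t - A t *m x t.
  by rewrite E addrAC subrr add0r.
by rewrite lee_fin (lagrange_pythagoras (psdW tT) Lt Bv) lerDl (psdW tT).2.
Qed.

Lemma derivable_lin (x y : R -> 'cV[R]_N) a t :
  derivable x t 1 -> derivable y t 1 ->
  derivable (fun s => a *: x s + y s) t 1 /\
  derive1 (fun s => a *: x s + y s) t = a *: derive1 x t + derive1 y t.
Proof.
move=> dx dy; have dax := derivableZ (k := a) dx.
split; first exact: (derivableD dax dy).
by rewrite !derive1E (deriveD dax dy) deriveZ.
Qed.

Lemma control_lin a x y : S x -> S y ->
  {ae leb R, forall t : lebT R, t \in `[0, T] ->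
    ctrl (fun s => a *: x s + y s) t = a *: ctrl x t + ctrl y t}.
Proof.
move=> Sx Sy; apply: filterS2 (control_lagrange Sx) (control_lagrange Sy).
move=> t Lx Ly tT; have [dx {}Lx] := Lx tT; have [dy {}Ly] := Ly tT.
rewrite {1}/control; apply: (wpinv_lagrange r0 (psdW tT) (coerW tT)).
have := lagrange_lin a Lx Ly; have [_ ->] := derivable_lin a dx dy.
by rewrite mulmxDr -scalemxAr scalerBr opprD addrACA.
Qed.

Lemma control_cross_integrable x y : S x -> S y ->
  (leb R).-integrable D
    (fun t : lebT R => (bform (W t) (ctrl x t) (ctrl y t))%:E).
Proof.
move=> Sx Sy.
apply: (le_integrable mD _ _
  (integrableD mD (control_energy Sx) (control_energy Sy))).
  apply/measurable_EFinP; apply: measurable_bform; first exact: L2W.1.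
    exact: control_measurable.
  exact: control_measurable.
move=> t tT; rewrite /= lee_fin [leRHS]ger0_norm.
  exact: psd_bform_le (psdW tT).
by rewrite addr_ge0// (psdW tT).2.
Qed.

Lemma state_integrable x y :
  absolutely_continuous T x -> absolutely_continuous T y ->
  (leb R).-integrable D (fun t : lebT R => (bform (Q t) (x t) (y t))%:E).
Proof.
move=> acx acy.
apply: (eq_integrable mD (fun t : lebT R =>
    \sum_i \sum_j ((x t i 0)%:E * ((Q t i j)%:E * (y t j 0)%:E)))%E).
  move=> t _; rewrite bformE -sumEFin; apply: eq_bigr => i _.
  by rewrite -sumEFin; apply: eq_bigr => j _; rewrite -!EFinM mulrA.
apply: (integrable_sum mD) => i _.
apply: (integrable_sum mD) => j _.
apply: (integrableMr mD).
- exact: ac_measurable.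
- exact: ac_bounded.
apply: (integrableMl mD).
- exact: L1Q.
- exact: ac_measurable.
- exact: ac_bounded.
Qed.

Lemma ipK_integrable x y : S x -> S y -> (leb R).-integrable D (fun t : lebT R =>
  (bform (Q t) (x t) (y t) + bform (W t) (ctrl x t) (ctrl y t))%:E).
Proof.
move=> Sx Sy; have [acx _] := Sx; have [acy _] := Sy.
exact: (integrableD mD (state_integrable acx acy)
  (control_cross_integrable Sx Sy)).
Qed.

Lemma trajectories_lin a x y : S x -> S y -> S (fun t => a *: x t + y t).
Proof.
move=> Sx Sy; split; first by apply: ac_lin; [case: Sx|case: Sy].
exists (fun t => a *: ctrl x t + ctrl y t).
have mx := control_measurable Sx; have my := control_measurable Sy.
split; first exact/measurable_mxD/my/measurable_mxZ.
  apply: filterS2 (control_lagrange Sx) (control_lagrange Sy).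
  move=> t Lx Ly tT; have [dx [Ex _]] := Lx tT; have [dy [Ey _]] := Ly tT.
  have [dxy ->] := derivable_lin a dx dy; split=> //.
  rewrite !mulmxDr -!scalemxAr Ex Ey scalerBr addrACA.
  by congr (_ + _); rewrite addrC subrK.
(* the three terms of the expanded energy of the combined control *)
have := integrableD mD (integrableZl mD (a ^+ 2) (control_energy Sx))
  (integrableD mD (integrableZl mD (2 * a) (control_cross_integrable Sx Sy))
     (control_energy Sy)).
move=> /integrable_lty => /(_ mD).
apply: le_lt_trans; rewrite le_eqVlt; apply/orP; left; apply/eqP.
apply: eq_integral => t; rewrite inE => /= tT.
rewrite (psd_bform_sqD _ _ (psdW tT)) !bformZl bformZr -!EFinM -!EFinD.
by congr (_%:E); ring.
Qed.

Lemma ipK_sym x y : ip x y = ip y x.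
Proof.
rewrite /ipK; apply: (congr2 +%R).
  by have := bform_sym (x 0) (y 0) (trmx1 R N); rewrite /bform !mulmx1.
apply: eq_Rintegral => t; rewrite inE => /= tT.
by rewrite (bform_sym _ _ (psdQ tT).1) (bform_sym _ _ (psdW tT).1).
Qed.

Lemma ipK_ge0 x : 0 <= ip x x.
Proof.
rewrite addr_ge0//; first by have := (psd_id N).2 (x 0); rewrite /bform mulmx1.
by apply: Rintegral_ge0 => t /= tT; rewrite addr_ge0 ?(psdQ tT).2 ?(psdW tT).2.
Qed.

Lemma ae_eq_Rintegral (f g : lebT R -> R) :
  (leb R).-integrable D (EFin \o f) -> (leb R).-integrable D (EFin \o g) ->
  {ae leb R, forall t : lebT R, t \in `[0, T] -> f t = g t} ->
  \int[leb R]_(t in `[0, T]) f t = \int[leb R]_(t in `[0, T]) g t.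
Proof.
move=> /measurable_int mf /measurable_int mg fg; congr fine.
apply: ae_eq_integral => //.
by apply: filterS fg => t fg /= tT; rewrite fg.
Qed.

Lemma ipK_linl a x y z : S x -> S y -> S z ->
  ip (fun t => a *: x t + y t) z = a * ip x z + ip y z.
Proof.
move=> Sx Sy Sz; have Sxy := trajectories_lin a Sx Sy.
have Ix := ipK_integrable Sx Sz; have Iy := ipK_integrable Sy Sz.
rewrite /ipK linearD linearZ /= mulmxDl -scalemxAl mxE [X in X + _ + _]mxE.
rewrite mulrDr addrACA; apply: (congr2 +%R) => [//|].
rewrite -RintegralZl ?mD// -RintegralD ?mD//; last first.
  exact: (integrableZl mD a Ix).
apply: ae_eq_Rintegral; first exact: ipK_integrable.
  exact: (integrableD mD (integrableZl mD a Ix) Iy).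
apply: filterS (control_lin a Sx Sy) => t E tT; rewrite E// !bformDl !bformZl.
by ring.
Qed.

(** Nonnegativity of |x + a y|^2 for all real a. *)
Lemma ipK_cauchy_schwarz x y : S x -> S y -> `|ip x y| <= norm x * norm y.
Proof.
move=> Sx Sy.
have quad a : 0 <= a ^+ 2 * ip y y + 2 * a * ip x y + ip x x.
  have Sa := trajectories_lin a Sy Sx.
  have := ipK_ge0 (fun t => a *: y t + x t).
  rewrite (ipK_linl _ Sy Sx Sa) (ipK_sym y) (ipK_sym x).
  rewrite (ipK_linl _ Sy Sx Sy) (ipK_linl _ Sy Sx Sx) (ipK_sym y x).
  move: (ip y y) (ip x y) (ip x x) => yy xy xx.
  by rewrite (_ : _ + _ = a ^+ 2 * yy + 2 * a * xy + xx) //; ring.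
rewrite /normK; move: (ipK_ge0 x) (ipK_ge0 y) quad.
move: (ip y y) (ip x y) (ip x x) => yy xy xx xx0 yy0 quad.
rewrite -(ler_pXn2r (n := 2))// ?nnegrE ?mulr_ge0 ?sqrtr_ge0//.
rewrite real_normK ?num_real// exprMn !sqr_sqrtr//.
have [yyE|yy_neq0] := eqVneq yy 0.
  suff -> : xy = 0 by rewrite expr0n mulr_ge0.
  (* otherwise the quadratic is affine and takes the value -1 *)
  apply/eqP; apply: contraT => xy0.
  have := quad (- (xx + 1) / (2 * xy)); rewrite yyE mulr0 add0r.
  rewrite (_ : _ + _ = -1) ?oppr_ge0 ?ler10//.
  by field.
have yy_gt0 : 0 < yy by rewrite lt_def yy_neq0.
(* the quadratic is minimal at - xy / yy *)
have := quad (- xy / yy).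
rewrite (_ : _ + _ = (xx * yy - xy ^+ 2) / yy); last by field.
by rewrite pmulr_lge0 ?invr_gt0// subr_ge0.
Qed.

Lemma ae_interior : {ae leb R, forall t : lebT R, t \in `[0, T] -> t \in `]0, T[}.
Proof.
have null a : (leb R).-negligible [set a].
  apply/negligibleP; last exact: lebesgue_measure_set1.
  by apply: sub_caratheodory; exact: (@measurable_set1 _ a).
apply: negligibleS (negligibleU (null 0) (null T)) => t /=.
rewrite !in_itv /= => /not_implyP[/andP[t0 tT]].
rewrite !lt_neqAle t0 tT !andbT => /negP; rewrite negb_and !negbK.
by case/orP => /eqP ->; [left|right].
Qed.

(** At the endpoints the derivatives may differ, since they also depend on the
    values outside [0, T]. *)
Lemma control_eq_in x y : (forall t, t \in `[0, T] -> x t = y t) ->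
  {ae leb R, forall t : lebT R, t \in `[0, T] -> ctrl x t = ctrl y t}.
Proof.
move=> xy; apply: filterS ae_interior => t inT tT.
suff Dxy : 'D_1 x t = 'D_1 y t by rewrite /control !derive1E Dxy (xy t tT).
apply: near_eq_derive; near=> s; apply: xy; apply: subset_itv_oo_cc.
by near: s; exact: near_in_itvoo (inT tT).
Unshelve. all: end_near. Qed.

Lemma ipK_eq_in x y : S x -> S y -> (forall t, t \in `[0, T] -> x t = y t) ->
  ip x x = ip y y.
Proof.
move=> Sx Sy xy.
have x0E : x 0 = y 0 by apply: xy; rewrite in_itv /= lexx ltW.
rewrite /ipK x0E; apply: (congr2 +%R) => [//|].
apply: (ae_eq_Rintegral (ipK_integrable Sx Sx) (ipK_integrable Sy Sy)).
apply: filterS (control_eq_in xy) => t cE tT.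
by rewrite (cE tT) (xy t tT).
Qed.

Lemma norm_dilation a x z : S x -> S z -> 0 <= a ->
  (forall t, t \in `[0, T] -> x t = a *: z t) -> norm x = a * norm z.
Proof.
move=> Sx Sz a0 xz.
(* the scaling as a linear combination of z with itself *)
have azE : (fun t => a *: z t) = (fun t => (a - 1) *: z t + z t).
  by apply: funext => t; rewrite scalerBl scale1r subrK.
have Saz : S (fun t => a *: z t) by rewrite azE; exact: trajectories_lin.
rewrite /normK (ipK_eq_in Sx Saz xz).
have linl y : S y -> ip (fun t => a *: z t) y = a * ip z y.
  by move=> Sy; rewrite azE ipK_linl//; ring.
rewrite linl// ipK_sym linl// mulrA -expr2 sqrtrM ?sqr_ge0// sqrtr_sqr.
by rewrite ger0_norm.
Qed.

(** The difference of the two values is the inner product of x with the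
    difference of the two representers. *)
Lemma reproducing_variation (K : R -> R -> 'M[R]_N) x s t p q :
  reproducing_kernel T A B Q W K -> S x -> s \in `[0, T] -> t \in `[0, T] ->
  `|(p^T *m x t) 0 0 - (q^T *m x s) 0 0|
  <= norm x * norm (fun z => K z s *m q - K z t *m p).
Proof.
move=> rkK Sx sT tT.
have [Sp xp] := rkK t tT p; have [Sq xq] := rkK s sT q.
rewrite xp// xq// distrC.
have -> : (fun z => K z s *m q - K z t *m p)
        = (fun z => -1 *: (K z t *m p) + K z s *m q).
  by apply: funext => z; rewrite scaleN1r addrC.
have -> : ip x (fun z => K z s *m q) - ip x (fun z => K z t *m p)
        = ip x (fun z => -1 *: (K z t *m p) + K z s *m q).
  by rewrite [RHS]ipK_sym ipK_linl// (ipK_sym _ x) (ipK_sym _ x) mulN1r addrC.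
by apply: ipK_cauchy_schwarz => //; exact: trajectories_lin.
Qed.

End TrajectorySpace.

(** * Windows and constraint sets *)

Lemma crow_mulmx (R : realType) (N P : nat) (C : R -> 'M[R]_(P, N)) t i
    (u : 'cV[R]_N) : ((crow C t i)^T *m u) 0 0 = (C t *m u) i 0.
Proof. by rewrite trmxK -row_mul mxE. Qed.

Lemma window_sub (R : realType) (T a b t : R) : a <= b ->
  window T a t `<=` window T b t.
Proof.
move=> ab s [] /=; rewrite !in_itv /= => /andP[h1 h2] sT; split=> //=.
rewrite in_itv /=; apply/andP; split; lra.
Qed.

Lemma window_center (R : realType) (T a t : R) : 0 <= a -> t \in `[0, T] ->
  window T a t t.
Proof. by move=> a0 tT; split=> //=; rewrite in_itv /= gerBl lerDl a0. Qed.

Theorem proposition1 (R : realType) (N M P : nat) (T : R)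
    (A : R -> 'M[R]_N) (B : R -> 'M[R]_(N, M)) (C : R -> 'M[R]_(P, N))
    (d : R -> 'cV[R]_P) (Q : R -> 'M[R]_N) (W : R -> 'M[R]_M) (r : R)
    (K : R -> R -> 'M[R]_N)
    (N0 : nat) (tm dm : 'I_N0 -> R) (delta : R) (eps : 'cV[R]_P) (y0 : R) :
  0 < T -> (0 < N)%N -> (0 < M)%N -> (0 < P)%N ->
  L1mx T A -> L2mx T B -> L1mx T Q -> L2mx T W ->
  (forall t, t \in `[0, T] -> psdmx (Q t)) ->
  (forall t, t \in `[0, T] -> psdmx (W t)) ->
  0 < r -> (forall t, t \in `[0, T] -> psdmx (W t - r%:M)) ->
  reproducing_kernel T A B Q W K ->
  finite_perturbations T A B Q W C d K ->
  (forall m, tm m \in `[0, T]) -> (forall m, 0 < dm m) ->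
  `[0, T] `<=` \bigcup_m [set` `[tm m - dm m, tm m + dm m]] ->
  \big[Num.max/0]_(m < N0) dm m <= delta ->
  lecv 0 eps ->
  0 <= y0 ->
  (forall i, ereal_sup
     [set ((y0 *: etavec T A B Q W C K delta t + omegavec T d delta t) i 0%R)%:E
       | t in `[0%R, T]] <= (eps i 0%R)%:E)%E ->
  [/\ V_eps T A B W C d eps `&` dilated_ballK T A B Q W y0
        `<=` V_inf T A B Q W C d K delta,
      V_inf T A B Q W C d K delta `<=` V_fin T A B Q W C d K tm dm
    & V_fin T A B Q W C d K tm dm `<=` V_0 T A B W C d].
Proof.
move=> T0 _ _ _ _ L2B L1Q L2W psdQ psdW r0 coerW rkK finK tmT dm0 cover dmax
  _ y0_ge0 eps_ge.
have dm_le m : dm m <= delta by apply: le_trans dmax; exact: le_bigmax.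
have delta0 : 0 <= delta by apply: le_trans dmax; exact: bigmax_ge_id.
split.
- move=> x [[Sx x_eps] [_ [z [Sz z1] xz]]]; split=> // t tT i.
  have nx : normK T A B Q W x <= y0.
    rewrite (norm_dilation T0 L2B L1Q L2W psdQ psdW r0 coerW Sx Sz y0_ge0 xz).
    by rewrite ler_piMr.
  have et : (y0 *: etavec T A B Q W C K delta t + omegavec T d delta t) i 0
      <= eps i 0.
    rewrite -lee_fin; apply: le_trans (eps_ge i); apply: ereal_sup_ubound.
    by exists t.
  have := x_eps t tT i; rewrite !mxE in et * => xt.
  have [eta_ub _ _] := finK delta t i delta0 tT.
  have eta0 : 0 <= sup (eta_set T A B Q W C K delta t i).
    apply: le_trans (ub_le_sup eta_ub _); last first.
      by exists t => //; exact: window_center.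
    exact: sqrtr_ge0.
  apply: le_trans xt; rewrite lerD2r; apply: le_trans et.
  by rewrite lerD2r ler_wpM2r.
- move=> x [Sx x_inf]; split=> // m i.
  have tT := tmT m; have wT := window_center (ltW (dm0 m)) tT.
  have [eta_ub om_ub _] := finK delta (tm m) i delta0 tT.
  have := x_inf _ tT i; rewrite !mxE => xt.
  have nx : 0 <= normK T A B Q W x := sqrtr_ge0 _.
  have eta_le : sup (eta_set T A B Q W C K (dm m) (tm m) i)
      <= sup (eta_set T A B Q W C K delta (tm m) i).
    apply: ge_sup.
      by exists (normK T A B Q W (fun z => K z (tm m) *m crow C (tm m) i
         - K z (tm m) *m crow C (tm m) i)), (tm m).
    move=> _ [s sw <-]; apply: ub_le_sup => //; exists s => //.
    exact: (window_sub (dm_le m) sw).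
  apply: lb_le_inf; first by exists (d (tm m) i 0), (tm m).
  move=> _ [s sw <-].
  have : `|d (tm m) i 0 - d s i 0| <= sup (omega_set T d delta (tm m) i).
    by apply: ub_le_sup => //; exists s => //; exact: window_sub sw.
  move=> /(le_trans (ler_norm _)) om_s.
  have := ler_wpM2l nx eta_le; lra.
- move=> x [Sx x_fin]; split=> // t tT i.
  have [m _ tm_t] := cover t tT.
  have wt : window T (dm m) (tm m) t by split.
  have [eta_ub _ d_lb] := finK (dm m) (tm m) i (ltW (dm0 m)) (tmT m).
  have := x_fin m i.
  rewrite mxE [X in X + _]mxE [X in _ * X]mxE [leRHS]mxE => xm.
  have := reproducing_variation L2B L1Q L2W psdQ psdW r0 coerW
    (crow C t i) (crow C (tm m) i) rkK Sx (tmT m) tT.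
  rewrite !crow_mulmx => /(le_trans (ler_norm _)); rewrite lerBlDl => var.
  have d_t := ge_inf d_lb (imageP _ wt).
  apply: le_trans var _; apply: le_trans d_t; apply: le_trans xm.
  rewrite addrC lerD2l; apply: ler_wpM2l; first exact: sqrtr_ge0.
  exact: (ub_le_sup eta_ub (imageP _ wt)).
Qed.
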